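(* Let $\mathcal{Y}$ be a real dual Banach space with separable predual and let $\Upsilon\subset\mathcal{Y}$ be non-empty, convex and weakly-$*$ sequentially compact. If $Z:\Upsilon\to\Upsilon$ is a weakly-$*$ sequentially continuous map, then $Z$ has at least one fixed point.
   Context: $\mathcal{Y}=\mathcal{X}^*$ for a separable Banach space $\mathcal{X}$ (the predual), and the weak-$*$ topology on $\mathcal{Y}$ is the one induced by $\mathcal{X}$. *)

(* Defs.v *)
From HB Require Import structures.
From mathcomp Require Import all_boot all_order all_algebra.
From mathcomp Require Import all_classical all_reals all_analysis.
Set Implicit Arguments.
Unset Strict Implicit.
Unset Printing Implicit Defensive.
Import Order.TTheory GRing.Theory Num.Theory.
Import numFieldNormedType.Exports.
Local Open Scope classical_set_scope.
Local Open Scope ring_scope.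

Definition separable_space (T : topologicalType) : Prop :=
  exists2 D : set T, countable D & dense D.

(* The limit of the extracted subsequence is required to lie in [A]. *)
Definition seq_compact (T : topologicalType) (A : set T) : Prop :=
  forall u : nat -> T, (forall n, A (u n)) ->
  exists s : nat -> nat, {homo s : m n / (m < n)%N} /\
  exists2 l : T, A l & u (s n) @[n --> \oo] --> l.

Definition seq_continuous_on (T U : topologicalType) (A : set T) (f : T -> U) :
    Prop :=
  forall (u : nat -> T) (l : T), (forall n, A (u n)) -> A l ->
  u n @[n --> \oo] --> l -> f (u n) @[n --> \oo] --> f l.

Section Dual.
Variables (R : realType) (X : normedModType R).

Definition dual_pred : {pred X -> R^o} :=
  fun f => `[< linear f /\ continuous f >].

Lemma dual_submod_closed : submod_closed dual_pred.
Proof.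
split.
  rewrite unfold_in; apply/asboolP; split; last by move=> x; exact: cvg_cst.
  by move=> a x y /=; rewrite scaler0 addr0.
move=> a f g /asboolP[lf cf] /asboolP[lg cg]; rewrite unfold_in; apply/asboolP.
split.
  move=> b x y.
  change (a *: f (b *: x + y) + g (b *: x + y) =
    b *: (a *: f x + g x) + (a *: f y + g y)).
  by rewrite lf lg !scalerDr !scalerA [a * b]mulrC addrACA.
move=> x; apply: (@cvgD _ _ _ _ _ (a *: f) g); last exact: cg.
by apply: cvgZl_tmp; exact: cf.
Qed.

HB.instance Definition _ :=
  GRing.isSubmodClosed.Build _ _ dual_pred dual_submod_closed.

(* Only the vector space X^* is built here: its norm topology is not used. *)
Record dual := Dual { dual_fun :> X -> R^o; _ : dual_fun \in dual_pred }.

HB.instance Definition _ := [isSub for dual_fun].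
HB.instance Definition _ := [Choice of dual by <:].
HB.instance Definition _ := [SubChoice_isSubLmodule of dual by <:].

(* X^* with the coarsest topology making all evaluations at points of X
   continuous. *)
Definition weak_star : Type :=
  initial_topology (dual_fun : dual -> {ptws X -> R^o}).

HB.instance Definition _ := Topological.on weak_star.
HB.instance Definition _ := GRing.Lmodule.on weak_star.

Lemma weak_star_cvgP (u : nat -> weak_star) (l : weak_star) :
  u n @[n --> \oo] --> l <->
  forall x : X, (u n : dual) x @[n --> \oo] --> (l : dual) x.
Proof.
have -> : (forall x : X, (u n : dual) x @[n --> \oo] --> (l : dual) x) <->
    {ptws, dual_fun (u n) @[n --> \oo] --> dual_fun l}.
  by split=> [h|/pointwise_cvgP h x]; [apply/pointwise_cvgP => x|]; exact: h.
split=> [ul|ul A].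
  apply: (cvg_comp u (dual_fun : weak_star -> {ptws X -> R^o}) ul).
  exact: (@initial_continuous dual {ptws X -> R^o} dual_fun).
move=> [_ [[B oB <-] Bl BA]].
by apply: filterS BA _; apply: ul; exact: open_nbhs_nbhs.
Qed.

End Dual.

(* Main.v *)
Require Import Defs.
From mathcomp Require Import all_boot all_order all_algebra.
From mathcomp Require Import all_classical all_reals all_analysis.
From mathcomp Require Import zify.
Set Implicit Arguments.
Unset Strict Implicit.
Unset Printing Implicit Defensive.
Import Order.TTheory GRing.Theory Num.Theory.
Import numFieldNormedType.Exports.

(** Write [ev f x] for the value of a functional [f] at [x].  It is enough to
    find, for finitely many test vectors d_0, ..., d_(m-1), a point y of the
    convex set U such that Z y and y agree at every d_k: if the d_k run through
    a dense sequence and y_m serves the first m of them, a subsequence of (y_m)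
    converges to some l in U, sequential continuity gives Z l = l at every d_k,
    and then everywhere because Z l and l are norm-continuous on X.

    For fixed test vectors put
      B(y, g) = \sum_(k < m) (Z y - y)(d_k) * g(d_k),
    which is linear in g.  The main step is a variational inequality: for
    finitely many points f_i of U there is y in U with B(y, f_i) <= B(y, y) for
    all i ([pairing_le_fin]).  Applied repeatedly, it yields h_0, h_1, ... in U
    with B(h_n, Z h_i) <= B(h_n, h_n) whenever i < n; along a convergent
    subsequence, with limit l, this becomes B(l, Z l) <= B(l, l), that is,
    \sum_(k < m) ((Z l - l)(d_k))^2 <= 0 ([fixed_on_tests]).

    The variational inequality is a Brouwer-type statement.  A point x of the
    grid of nonnegative integer vectors of sum n indexes a convex combination of
    the f_i; colour x by an index i maximizing B(., f_i) there.  A Sperner-type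
    lemma for grids ([grid_colouring]) provides points x_i, within a distance of
    one another that does not depend on n, such that for each i either x_i has
    colour i, or the i-th coordinate of every x_j is bounded independently of n.
    After rescaling by 1/n and passing to a limit, the weight is carried by
    indices maximizing B(l, .), whence the inequality.

    The Sperner-type lemma is deduced from Scarf's theorem on families of linear
    orders ([colourful_dominant_set]), whose parity argument needs no
    triangulation.  In a finite set with linear orders indexed by I, a subset is
    dominant if no element exceeds all its minima at once.  Call rooms the
    dominant subsets with #|I| elements, and doors those with #|I| - 1 elements
    that show every colour other than a fixed one.  All doors lie in exactly two
    rooms, except for one door, which lies in a single room, while a room that
    misses a colour contains an even number of doors; so some room shows all the
    colours. *)

(** * Scarf's colouring theorem *)

Section Combinatorics.
(* The lemmas on finite sets take precedence over their homonyms on classical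
   sets. *)
Import boot.fintype boot.finset.
Local Open Scope nat_scope.

(** A map whose image has one element less than its source identifies exactly
    one pair of points, and deleting either point makes it injective without
    changing its image. *)
Lemma imset_card_succ_collision (aT rT : finType) (f : aT -> rT) (A : {set aT}) :
  #|A| = #|f @: A|.+1 ->
  exists u v, [/\ u \in A, v \in A, u != v, f u = f v &
    [/\ f @: (A :\ u) = f @: A, f @: (A :\ v) = f @: A,
        {in A :\ u &, injective f} & {in A :\ v &, injective f}]].
Proof.
move=> cA.
have [u [v [uA vA uv fuv]]] :
    exists u v, [/\ u \in A, v \in A, u != v & f u = f v].
  have : ~~ dinjectiveb f (mem A).
    apply/dinjectiveP => inj.
    have : #|f @: A| = #|A| by exact: card_in_imset.
    by lia.
  by move=> /dinjectivePn[u uA [v /andP[/= vu vA] fuv]]; exists u, v; rewrite eq_sym.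
have del w w' : w \in A -> w' \in A -> w != w' -> f w = f w' ->
    f @: (A :\ w) = f @: A.
  move=> wA w'A ww' fww'; apply/eqP; rewrite eqEsubset imsetS ?subD1set//=.
  apply/subsetP => _ /imsetP[x xA ->]; have [->|xw] := eqVneq x w.
    by rewrite fww' imset_f// !inE eq_sym ww'.
  by rewrite imset_f// !inE xw.
have inj w : w \in A -> f @: (A :\ w) = f @: A -> {in A :\ w &, injective f}.
  move=> wA fA; apply/imset_injP; rewrite fA.
  by have := cardsD1 w A; rewrite wA; lia.
have fu := del _ _ uA vA uv fuv.
have fv : f @: (A :\ v) = f @: A by apply: (del v u) => //; rewrite eq_sym.
by exists u, v; split => //; split => //; exact: inj.
Qed.

(** The ground set is [T + I]: the points of [T] together with one slack element
    [inr i] for each order [i]. The order of index [i] is given by an injective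
    rank function [r i]; in it [inr i] is the least element, and the other slack
    elements are above all points of [T]. *)
Section Scarf.
Variables (T I : finType) (t0 : T) (r : I -> T + I -> nat).
Hypothesis r_inj : forall i, injective (r i).
Hypothesis r_slack_min : forall i v, v != inr i -> r i (inr i) < r i v.
Hypothesis r_slack_max : forall i j x, i != j -> r i (inl x) < r i (inr j).

(** [S] is dominant when no element of the ground set exceeds, in every order at
    once, the minimum of [S] in that order. *)
Definition dominant (S : {set T + I}) : bool :=
  [forall y, exists i, [forall x in S, r i y <= r i x]].

Lemma dominantP (S : {set T + I}) :
  reflect (forall y, exists i, forall x, x \in S -> r i y <= r i x) (dominant S).
Proof.
apply: (iffP forallP) => H y.
  by have /existsP[i /forall_inP] := H y; exists i.
by have [i Hi] := H y; apply/existsP; exists i; exact/forall_inP.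
Qed.

Lemma dominantS (S S' : {set T + I}) : S \subset S' -> dominant S' -> dominant S.
Proof.
move=> /subsetP sS /dominantP dS; apply/dominantP => y.
by have [i Hi] := dS y; exists i => x /sS; exact: Hi.
Qed.

Variables (c : T -> I) (i0 : I).

(** The colouring [c] of [T], extended to the slack elements by giving [inr i]
    the colour [i]. *)
Definition colour (v : T + I) : I := match v with inl x => c x | inr i => i end.

(** The dominant sets with as many elements as there are orders. *)
Definition room : {set {set T + I}} := [set S | dominant S & #|S| == #|I|].

(** The dominant sets with one element less than a room that show every colour
    other than [i0]; their elements therefore have distinct colours. *)
Definition door : {set {set T + I}} :=
  [set S | [&& dominant S, #|S| == #|I|.-1 & colour @: S == [set~ i0]]].

(** The only door contained in a single room. *)
Definition outer_door : {set T + I} := inr @: [set~ i0].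

Lemma cardI_gt0 : 0 < #|I|.
Proof. by apply/card_gt0P; exists i0. Qed.

Lemma cardsC0 : #|[set~ i0]| = #|I|.-1.
Proof. by have := cardsC1 i0; lia. Qed.

Lemma room_setU1 (S tau : {set T + I}) : tau \in door -> S \in room ->
  tau \subset S -> exists2 z, z \notin tau & S = z |: tau.
Proof.
rewrite !inE => /and3P[_ /eqP ct _] /andP[_ /eqP cS] tS.
have cD : #|S :\: tau| = 1.
  have := cardsID tau S; rewrite (setIidPr tS).
  by have := cardI_gt0; lia.
have /cards1P[z zP] : #|S :\: tau| == 1 by rewrite cD.
have : z \in S :\: tau by rewrite zP inE.
rewrite !inE => /andP[zt zS]; exists z => //.
by rewrite -(setID S tau) zP (setIidPr tS) setUC.
Qed.

Lemma setU1_room (tau : {set T + I}) z : tau \in door -> z \notin tau ->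
  (z |: tau \in room) = dominant (z |: tau).
Proof.
rewrite !inE => /and3P[_ /eqP ct _] zt; rewrite cardsU1 zt ct.
have := cardI_gt0 => ?.
by rewrite (_ : (_ + _ == _)%N = true) ?andbT//; apply/eqP; move: zt; lia.
Qed.

Lemma outer_door_in : outer_door \in door.
Proof.
rewrite inE card_imset; last by move=> ? ? [].
rewrite cardsC0 eqxx /= -imset_comp.
apply/andP; split; last first.
  by apply/eqP; rewrite -[RHS]imset_id; exact: eq_imset.
apply/dominantP => -[x|j].
  by exists i0 => _ /imsetP[i /[!inE] ii0 ->]; rewrite ltnW// r_slack_max// eq_sym.
exists j => v _; have [->//|/r_slack_min/ltnW//] := eqVneq v (inr j).
Qed.

(** The unique room containing the outer door is obtained by adding the greatest
    point of [T] in the order [i0]. *)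
Lemma rooms_outer_door :
  #|[set S in room | outer_door \subset S]| = 1.
Proof.
pose x0 := [arg max_(x > t0) r i0 (inl x)].
have x0max x : r i0 (inl x) <= r i0 (inl x0).
  by rewrite /x0; case: arg_maxnP => // y _; exact.
apply/eqP/cards1P; exists (inl x0 |: outer_door).
have x0n : inl x0 \notin outer_door by apply/imsetP => -[].
apply/setP => S; rewrite [in LHS]inE [in RHS]inE.
apply/idP/eqP => [/andP[SR oS]|->]; last first.
  rewrite subsetUr setU1_room ?outer_door_in// andbT.
  apply/dominantP => -[x|j]; last first.
    by exists j => v _; have [->//|/r_slack_min/ltnW//] := eqVneq v (inr j).
  exists i0 => v /setU1P[->//|/imsetP[i /[!inE] ii0 ->]].
  by rewrite ltnW// r_slack_max// eq_sym.
have [z zo Sz] := room_setU1 outer_door_in SR oS.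
move: SR; rewrite Sz setU1_room ?outer_door_in// => /dominantP dS.
have zmax x : r i0 (inl x) <= r i0 z.
  have [i Hi] := dS (inl x).
  have [<-|ii0] := eqVneq i i0; first by apply: Hi; rewrite setU11.
  have io : inr i \in z |: outer_door by rewrite setU1r// imset_f// !inE.
  by have := Hi _ io; rewrite leqNgt r_slack_min.
case: z => [z|j] in zo Sz dS zmax *.
  suff -> : z = x0 by [].
  have zx0 : r i0 (inl z) = r i0 (inl x0).
    by apply/eqP; rewrite eqn_leq x0max zmax.
  by case: (r_inj zx0).
have j0 : j = i0.
  by apply/eqP; apply: contraNT zo => ji0; rewrite imset_f// !inE.
by have := zmax t0; rewrite j0 leqNgt r_slack_min.
Qed.

(** Let [m i] be the minimum of the door [tau] in the order [i].  By dominance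
    [m] maps [I] onto [tau], so that it identifies exactly two indices [a] and
    [b].  A room containing [tau] adds an element that becomes the minimum in
    one order [j]; as each element of a room is the minimum in some order, [j]
    must be [a] or [b], and the added element must be the greatest one, in the
    order [j], among those exceeding [m i] for all [i != j]. *)
Lemma rooms_inner_door (tau : {set T + I}) : tau \in door -> tau != outer_door ->
  #|[set S in room | tau \subset S]| = 2.
Proof.
move=> tD; move: (tD); rewrite inE => /and3P[/dominantP dt /eqP ct /eqP colt] tno.
(* A door without points of [T] consists of the slack elements of its colours. *)
have [t tt] : exists t, inl t \in tau.
  apply/existsP; apply: contraNT tno => /existsPn tn.
  rewrite eqEsubset; apply/andP; split; last first.
    apply/subsetP => _ /imsetP[i /[!inE] ii0 ->].
    have : i \in colour @: tau by rewrite colt !inE.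
    by case/imsetP => -[x|j] jt ->//; rewrite (negPf (tn x)) in jt.
  apply/subsetP => -[x|i] it.
    by rewrite (negPf (tn x)) in it.
  by rewrite imset_f// -colt; apply/imsetP; exists (inr i).
pose m i := [arg min_(x < inl t in tau) r i x].
have mt i : m i \in tau by rewrite /m; case: arg_minnP.
have mle i x : x \in tau -> r i (m i) <= r i x.
  by rewrite /m; case: arg_minnP => // y _; exact.
have meq i x : x \in tau -> (forall y, y \in tau -> r i x <= r i y) -> m i = x.
  move=> xt xmin; apply: (@r_inj i).
  by have := mle i x xt; have := xmin _ (mt i); lia.
have imm : m @: setT = tau.
  apply/setP => y; apply/imsetP/idP => [[i _ ->]//|yt].
  by have [i Hi] := dt y; exists i => //; rewrite (meq i y).
have := @imset_card_succ_collision _ _ m setT.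
rewrite imm cardsT ct => /(_ ltac:(have := cardI_gt0; lia)).
case=> a [b [_ _ ab mab [ima imb inja injb]]].
(* The slack element [inr j] witnesses that [M j] is nonempty: [tau] contains a
   point of [T], which lies below [inr j] in every order [i != j]. *)
pose M j := [pred y | [forall i, (i != j) ==> (r i (m i) < r i y)]].
have Mslack j : M j (inr j).
  apply/forallP => i; apply/implyP => ij.
  exact: leq_ltn_trans (mle i _ tt) (r_slack_max _ ij).
pose x j := [arg max_(y > inr j | M j y) r j y].
have xM j i : i != j -> r i (m i) < r i (x j).
  by rewrite /x; case: arg_maxnP => // y /forallP/(_ i)/implyP yP _; exact: yP.
have xmax j y : (forall i, i != j -> r i (m i) < r i y) -> r j y <= r j (x j).
  rewrite /x; case: arg_maxnP => // z _ zmax yM; apply: zmax.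
  by apply/forallP => i; apply/implyP; exact: yM.
have xlt j : r j (x j) <= r j (m j).
  have [i Hi] := dt (x j).
  have [ij|ij] := eqVneq i j; first by rewrite ij in Hi; exact: Hi.
  by have := xM _ _ ij; have := Hi _ (mt i); lia.
have xnt j : m @: (setT :\ j) = tau -> x j \notin tau.
  move=> imj; apply/negP; rewrite -imj => /imsetP[i] /[!inE]/= /[!andbT] ij xji.
  by have := xM _ _ ij; rewrite xji ltnn.
have xdom j : m @: (setT :\ j) = tau -> dominant (x j |: tau).
  move=> imj; apply/dominantP => y.
  have [/existsP[i /andP[ij Hi]]|] :=
      boolP [exists i, (i != j) && (r i y <= r i (m i))].
    exists i => v /setU1P[->|/mle vt]; last by move: (vt i); lia.
    by have := xM _ _ ij; lia.
  move=> /existsPn yn; exists j => v.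
  have yx : r j y <= r j (x j).
    by apply: xmax => i ij; have := yn i; rewrite ij /=; lia.
  by move=> /setU1P[->//|/(mle j)]; have := xlt j; lia.
have xz z : z \notin tau -> dominant (z |: tau) -> z = x a \/ z = x b.
  move=> zt /dominantP dz.
  (* The orders in which [z] becomes the minimum; there is only one. *)
  pose J := [set i | r i z < r i (m i)].
  have mJ : m @: (~: J) = tau.
    apply/setP => y; apply/imsetP/idP => [[i _ ->]//|yt].
    have [i Hi] := dz y; exists i.
      rewrite !inE -leqNgt; apply: leq_trans (mle i _ yt) _.
      by apply: Hi; rewrite setU11.
    by rewrite (meq i y)// => w wt; apply: Hi; rewrite setU1r.
  have [j Hj] := dz z.
  have jJ : j \in J.
    rewrite inE ltn_neqAle Hj ?setU1r// andbT; apply/eqP => /r_inj zm.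
    by rewrite zm mt in zt.
  have JP : J = [set j].
    apply/esym/eqP; rewrite eqEcard sub1set jJ cards1 /=.
    have := leq_imset_card m (~: J); rewrite mJ ct.
    by have := cardsC J; have := cardI_gt0; lia.
  have zM i : i != j -> r i (m i) < r i z.
    move=> ij; have : i \notin J by rewrite JP inE.
    rewrite inE -leqNgt leq_eqVlt => /orP[/eqP/r_inj zm|//].
    by rewrite -zm mt in zt.
  have zx : z = x j.
    apply: (@r_inj j); apply/eqP; rewrite eqn_leq xmax//=.
    have [i Hi] := dz (x j).
    have [ij|ij] := eqVneq i j; first by rewrite ij in Hi; apply: Hi; rewrite setU11.
    have := xM _ _ ij; have := Hi (m i); rewrite setU1r ?mt// => /(_ erefl).
    by lia.
  have [ja|ja] := eqVneq j a; first by left; rewrite zx ja.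
  have [jb|jb] := eqVneq j b; first by right; rewrite zx jb.
  have : m j \in m @: (~: J) by rewrite mJ mt.
  case/imsetP => i; rewrite JP !inE => ij mji.
  have [ia|ia] := eqVneq i a.
    have ib : i != b by rewrite ia.
    have := injb j i; rewrite !inE jb ib => /(_ erefl erefl mji) ji.
    by rewrite ji eqxx in ij.
  have := inja j i; rewrite !inE ja ia => /(_ erefl erefl mji) ji.
  by rewrite ji eqxx in ij.
have xab : x a != x b.
  apply/eqP => xE; have := xM a b; rewrite eq_sym ab => /(_ erefl).
  by have := xlt b; rewrite xE; lia.
rewrite (_ : [set S in room | tau \subset S] = [set x a |: tau; x b |: tau]).
  rewrite cards2 (_ : _ != _)//; apply: contra_neq xab => xE.
  have : x a \in x b |: tau by rewrite -xE setU11.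
  by rewrite in_setU1 (negPf (xnt a ima)) orbF => /eqP.
apply/setP => S; rewrite [in LHS]inE [in RHS]in_set2; apply/andP/orP.
  move=> [SR tS]; have [z zt Sz] := room_setU1 tD SR tS.
  have : dominant (z |: tau) by rewrite -setU1_room// -Sz.
  by move=> /(xz _ zt)[] zx; [left|right]; rewrite Sz zx.
by case=> /eqP ->; rewrite subsetUr setU1_room ?xnt ?xdom.
Qed.

(** If a room misses a colour and has a door, its colours are those of the door,
    so exactly two of its elements share a colour; its doors are obtained by
    deleting one of these two. *)
Lemma doors_of_room S : S \in room -> colour @: S != setT ->
  ~~ odd #|[set tau in door | tau \subset S]|.
Proof.
move=> SR nS; have [->|[tau]] := set_0Vmem [set tau in door | tau \subset S].
  by rewrite cards0.
rewrite inE => /andP[tD tS]; have [z zt Sz] := room_setU1 tD SR tS.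
have colS : colour @: S = [set~ i0].
  move: nS tD; rewrite inE Sz imsetU1 => /[swap] /and3P[_ _ /eqP ->] nS.
  apply/setUidPr; rewrite sub1set !inE; apply: contra nS => /eqP ->.
  by apply/eqP/setP => i; rewrite !inE orbN.
move: (SR); rewrite inE => /andP[dS /eqP cS].
have := @imset_card_succ_collision _ _ colour S.
rewrite colS cardsC0 cS => /(_ ltac:(have := cardI_gt0; lia)).
case=> u [v [uS vS uv cuv [colu colv _ _]]].
have dr w : w \in S -> colour @: (S :\ w) = [set~ i0] -> S :\ w \in door.
  move=> wS colw; rewrite inE colw eqxx (dominantS (subD1set _ _) dS)/= andbT.
  by have := cardsD1 w S; rewrite wS cS => ->.
rewrite (_ : [set _ in door | _] = [set S :\ u; S :\ v]).
  rewrite cards2 (_ : _ != _)//; apply: contraTneq uS => SE.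
  have : u \in S :\ v = false by rewrite -SE !inE eqxx.
  by rewrite !inE uv /= => ->.
apply/setP => t; rewrite [in LHS]inE [in RHS]in_set2; apply/andP/orP; last first.
  by case=> /eqP ->; rewrite subD1set dr.
move=> [td tsS]; have [w wt Sw] := room_setU1 td SR tsS.
have tE : t = S :\ w by rewrite Sw setU1K.
have wuv : w = u \/ w = v.
  have [->|wu] := eqVneq w u; first by left.
  have [->|wv] := eqVneq w v; first by right.
  have injt : {in t &, injective colour}.
    apply/imset_injP; move: td; rewrite inE => /and3P[_ /eqP -> /eqP ->].
    by rewrite cardsC0.
  have : u = v by apply: injt => //; rewrite tE !inE ?uS ?vS eq_sym ?wu ?wv.
  by move/eqP: uv.
by case: wuv => <-; [left|right]; rewrite tE.
Qed.

(** Double counting of the pairs of a door and a room containing it: if all rooms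
    missed a colour, the number of pairs would be even by [doors_of_room], but it
    is odd because of the outer door. *)
Theorem colourful_dominant_set :
  exists2 S, dominant S /\ #|S| = #|I| & colour @: S = setT.
Proof.
have [/exists_inP[S]|/exists_inPn nS] :=
  boolP [exists S in room, colour @: S == setT].
  by rewrite inE => /andP[dS /eqP cS] /eqP colS; exists S.
have incE : \sum_(tau in door) #|[set S in room | tau \subset S]| =
            \sum_(S in room) #|[set tau in door | tau \subset S]|.
  under eq_bigr do rewrite -sum1dep_card.
  under [RHS]eq_bigr do rewrite -sum1dep_card.
  rewrite (exchange_big_dep (mem room))/=; last by move=> tau S _ /andP[].
  by apply: eq_bigr => S SR; apply: eq_bigl => tau; rewrite SR.
have : odd (\sum_(tau in door) #|[set S in room | tau \subset S]|).
  rewrite (bigD1 _ outer_door_in)/= rooms_outer_door oddD/=.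
  rewrite (eq_bigr (fun=> 2)); first by rewrite sum_nat_const oddM andbF.
  by move=> tau /andP[]; exact: rooms_inner_door.
rewrite incE => oddS; exfalso; move: oddS; apply/negP.
elim/big_ind : _ => [//|a b|S SR]; first by rewrite oddD => /negPf -> /negPf ->.
exact: doors_of_room (nS _ SR).
Qed.

End Scarf.

(** * A Sperner-type lemma for integer grids *)

Section Grid.
Variables (I : finType) (i0 : I) (m : nat).

(** The vectors of nonnegative integers indexed by [I] and of sum [m]. *)
Definition grid := {x : {ffun I -> 'I_m.+1} | \sum_i x i == m}.

Definition coords (x : grid) : {ffun I -> nat} := [ffun i => val x i : nat].

Lemma sum_coords x : \sum_i coords x i = m.
Proof. by rewrite -[RHS](eqP (valP x)); apply: eq_bigr => i _; rewrite ffunE. Qed.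

Lemma coords_le x i : coords x i <= m.
Proof. by rewrite ffunE -ltnS. Qed.

Lemma coords_surj (f : I -> nat) : \sum_i f i = m ->
  exists x : grid, forall i, coords x i = f i.
Proof.
move=> fm; have fle i : f i < m.+1 by rewrite ltnS -fm (bigD1 i)//= leq_addr.
pose y := [ffun i => Ordinal (fle i)].
have yP : \sum_i y i == m.
  by rewrite -[eqbRHS]fm; apply/eqP/eq_bigr => i _; rewrite ffunE.
by exists (exist _ y yP) => i; rewrite !ffunE.
Qed.

(** The order of index [i] compares the [i]-th coordinates and breaks ties by an
    enumeration of the grid. *)
Definition grid_rank (i : I) (v : grid + I) : nat :=
  match v with
  | inl x => (coords x i * #|{: grid}| + enum_rank x).+1
  | inr j => if j == i then 0 else (m.+1 * #|{: grid}| + enum_rank j).+1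
  end.

Lemma grid_rank_bound i x :
  coords x i * #|{: grid}| + enum_rank x < m.+1 * #|{: grid}|.
Proof.
have aux a b k : b < k -> a <= m -> a * k + b < m.+1 * k by nia.
exact: aux (ltn_ord _) (coords_le x i).
Qed.

Lemma grid_rank_inj i : injective (grid_rank i).
Proof.
case=> [x|j] [y|k] /=.
- case=> /(congr1 (modn^~ #|{: grid}|)); rewrite !modnMDl !modn_small//.
  by move=> /val_inj/enum_rank_inj ->.
- by case: eqP => // _ [e]; have := grid_rank_bound i x; rewrite e; lia.
- by case: eqP => // _ [e]; have := grid_rank_bound i y; rewrite -e; lia.
- case: eqP => [->|_]; case: eqP => [->|_]// [].
  by move=> /addnI/val_inj/enum_rank_inj ->.
Qed.

Lemma grid_rank_slack_min i v : v != inr i -> grid_rank i (inr i) < grid_rank i v.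
Proof.
by rewrite /= eqxx; case: v => //= j; case: (eqVneq j i) => [->|//]; rewrite eqxx.
Qed.

Lemma grid_rank_slack_max i j x : i != j ->
  grid_rank i (inl x) < grid_rank i (inr j).
Proof.
rewrite eq_sym => /negPf /= ->; rewrite ltnS.
exact: leq_trans (grid_rank_bound i x) (leq_addr _ _).
Qed.

Lemma grid_rank_coords i x y : grid_rank i (inl y) <= grid_rank i (inl x) ->
  coords y i <= coords x i.
Proof.
have aux a b a' b' k : b < k -> a' * k + b' <= a * k + b -> a' <= a by nia.
by rewrite /= ltnS => /(aux _ _ _ _ _ (ltn_ord _)).
Qed.

(** For the orders [grid_rank], dominance of [S] means that no grid point exceeds
    the minima [a i] of the [i]-th coordinates over the points of [S], for all
    [i] in the set [C] of the indices whose slack element is not in [S].  Hence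
    the numbers [a i + 1], for [i] in [C], have a sum greater than [m].  Since a
    point of [S] has sum [m], its coordinates outside [C] and the excesses of the
    others over [a i] are at most [#|I|]. *)
Lemma grid_colouring (c : {ffun I -> nat} -> I) :
  exists x : I -> {ffun I -> nat},
    [/\ forall i, \sum_k x i k = m,
        forall i j k, x i k <= x j k + #|I| &
        forall i, c (x i) = i \/ forall j, x j i <= #|I|].
Proof.
have [t0 _] : exists x : grid, forall i, coords x i = if i == i0 then m else 0.
  by apply: coords_surj; rewrite -big_mkcond big_pred1_eq.
have [S [/dominantP dS cS] colS] := colourful_dominant_set t0 grid_rank_inj
  grid_rank_slack_min grid_rank_slack_max (c \o coords) i0.
pose C := [set i | inr i \notin S].
have colP i : i \in C -> exists x, inl x \in S /\ c (coords x) = i.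
  have : i \in colour (c \o coords) @: S by rewrite colS inE.
  case/imsetP => -[x|j] vS ->; last by rewrite inE vS.
  by move=> _; exists x.
have domC y : exists2 i, i \in C & forall x, inl x \in S -> coords y i <= coords x i.
  have [i Hi] := dS (inl y); exists i.
    by rewrite inE; apply/negP => /Hi; rewrite leqNgt grid_rank_slack_min.
  by move=> x /Hi; exact: grid_rank_coords.
have [i1 i1C _] := domC t0; have [x1 [x1S _]] := colP _ i1C.
pose a i := coords [arg min_(x < x1 | inl x \in S) coords x i] i.
have aP i : exists2 x, inl x \in S & a i = coords x i.
  by rewrite /a; case: arg_minnP => // x xS _; exists x.
have ale i x : inl x \in S -> a i <= coords x i.
  by rewrite /a; case: arg_minnP => // y _; exact.
(* Otherwise raising each [a i] by one, and one of them further so as to reach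
   the sum [m], would contradict dominance. *)
have m_lt : m < \sum_(i in C) (a i).+1.
  rewrite ltnNge; apply/negP => am.
  pose f i := if i \in C then
    (a i).+1 + (if i == i1 then m - \sum_(i in C) (a i).+1 else 0) else 0.
  have [|y yf] := @coords_surj f.
    rewrite -big_mkcond big_split/= -big_mkcondr/=.
    rewrite [X in _ + X](big_pred1 i1) ?subnKC// => i /=.
    by case: eqP => [->|_]; rewrite ?i1C ?andbF.
  have [i iC] := domC y; have [x xS xa] := aP i.
  by move=> /(_ _ xS); rewrite yf /f iC -xa; lia.
have sumC x : inl x \in S ->
    \sum_(i in C) coords x i + \sum_(i in ~: C) coords x i = m.
  move=> xS; rewrite -[RHS](sum_coords x) (bigID (mem C) predT)/=; congr addn.
  by apply: eq_bigl => i; rewrite inE.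
have cC : \sum_(i in C) (a i).+1 <= \sum_(i in C) a i + #|I|.
  under eq_bigr do rewrite -addn1.
  by rewrite big_split/= leq_add2l sum1_card max_card.
have inC x k : inl x \in S -> k \in C -> coords x k <= a k + #|I|.
  move=> xS kC; have := sumC x xS.
  have : \sum_(i in C | i != k) a i <= \sum_(i in C | i != k) coords x i.
    by apply: leq_sum => i _; exact: ale.
  have -> : \sum_(i in C) coords x i =
      coords x k + \sum_(i in C | i != k) coords x i by rewrite (bigD1 k kC).
  have aC : \sum_(i in C) a i = a k + \sum_(i in C | i != k) a i.
    by rewrite (bigD1 k kC).
  by move: m_lt cC; rewrite aC; lia.
have notinC x k : inl x \in S -> k \notin C -> coords x k <= #|I|.
  move=> xS kC; have := sumC x xS.
  have : \sum_(i in C) a i <= \sum_(i in C) coords x i.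
    by apply: leq_sum => i _; exact: ale.
  have kC' : k \in ~: C by rewrite in_setC.
  have : coords x k <= \sum_(i in ~: C) coords x i.
    by rewrite (bigD1 k kC')/= leq_addr.
  by move: m_lt cC; lia.
have /fin_all_exists[x xP] :
    forall i, exists x, inl x \in S /\ (i \in C -> c (coords x) = i).
  move=> i; have [/colP[x [xS cx]]|] := boolP (i \in C); last by exists x1.
  by exists x.
exists (coords \o x); split=> [i|i j k|i]/=; first exact: sum_coords.
  have [xi _] := xP i; have [xj _] := xP j; have [kC|kC] := boolP (k \in C).
    by apply: leq_trans (inC _ _ xi kC) _; rewrite leq_add2r ale.
  exact: leq_trans (notinC _ _ xi kC) (leq_addl _ _).
have [xi cx] := xP i; have [/cx|iC] := boolP (i \in C); first by left.
by right=> j; have [xj _] := xP j; exact: notinC.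
Qed.

End Grid.

End Combinatorics.

Local Open Scope classical_set_scope.
Local Open Scope ring_scope.

(** * Evaluation of functionals and convex combinations *)

Lemma cvg_strict_homo_nat (s : nat -> nat) :
  {homo s : m n / (m < n)%N} -> s @ \oo --> \oo.
Proof.
move=> smono A [N _ NA]; have sge n : (n <= s n)%N.
  by elim: n => // n /leq_ltn_trans; apply; exact: smono.
by exists N => // n /= Nn; apply: NA => /=; exact: leq_trans (sge n).
Qed.

Lemma convex_set_sum (R : realFieldType) (M : lmodType R)
    (A : set (convex_lmodType M)) (I : Type) (r : seq I) (t : I -> R)
    (f : I -> M) :
  convex_set A -> (forall i, 0 <= t i) -> \sum_(i <- r) t i = 1 ->
  (forall i, A (f i)) -> A (\sum_(i <- r) t i *: f i).
Proof.
move=> cA t0 + fA; case: r => [|i0 r].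
  by rewrite big_nil => /esym/eqP; rewrite oner_eq0.
(* Stated for an unnormalized sum, so that the induction applies to its tail. *)
suff [y Ay ->] : exists2 y : M, A y &
    \sum_(i <- i0 :: r) t i *: f i = (\sum_(i <- i0 :: r) t i) *: y.
  by move=> ->; rewrite scale1r.
elim: (i0 :: r) => [|i r' [y Ay yE]].
  by exists (f i0) => //; rewrite !big_nil scale0r.
rewrite !big_cons yE; set S := \sum_(j <- r') t j.
have S0 : 0 <= S by exact: sumr_ge0.
have [tS|tS] := eqVneq (t i + S) 0.
  have /andP[/eqP -> /eqP ->] : (t i == 0) && (S == 0).
    by rewrite -paddr_eq0// tS.
  by exists y => //; rewrite addr0 !scale0r addr0.
have tS_gt0 : 0 < t i + S by rewrite lt_neqAle eq_sym tS addr_ge0.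
have p01 : 0 <= t i / (t i + S) <= 1.
  by rewrite divr_ge0 ?ler_pdivrMr ?mul1r ?lerDl ?t0 // ltW.
pose p : {i01 R} := Itv01 (andP p01).1 (andP p01).2.
exists (conv p (f i : convex_lmodType M) (y : convex_lmodType M)).
  by apply/set_mem/cA; exact/mem_set.
rewrite scalerDr !scalerA; congr (_ *: _ + _ *: _) => /=.
  by rewrite mulrC divfK.
by rewrite /unstable.onem mulrBr mulr1 mulrCA divff// mulr1 addrC addKr.
Qed.

Section Evaluation.
Variables (R : realType) (X : normedModType R).
Implicit Types (f g : weak_star X) (x : X).

(** The value of the functional [f] at [x], as a scalar in [R]. *)
Definition ev f x : R := dual_fun f x.

Lemma evZ a f x : ev (a *: f) x = a * ev f x. Proof. by []. Qed.

Lemma ev_sum (I : Type) (r : seq I) (F : I -> weak_star X) x :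
  ev (\sum_(i <- r) F i) x = \sum_(i <- r) ev (F i) x.
Proof. by elim/big_rec2 : _ => // i a b _ <-. Qed.

Lemma ev_inj f g : ev f =1 ev g -> f = g.
Proof. by move=> fg; apply: val_inj; apply/funext => x; exact: fg. Qed.

Lemma ev_continuous f : continuous (ev f).
Proof. by have := valP f; rewrite unfold_in => /asboolP[]. Qed.

Lemma ev_cvgP (u : nat -> weak_star X) (l : weak_star X) :
  u n @[n --> \oo] --> l <-> forall x, ev (u n) x @[n --> \oo] --> ev l x.
Proof. exact: weak_star_cvgP. Qed.
End Evaluation.

(** * Existence of fixed points *)

Section FixedPoint.
Variables (R : realType) (X : normedModType R) (U : set (weak_star X)).
Hypothesis U_neq0 : U !=set0.
Hypothesis U_convex : convex_set (U : set (convex_lmodType (weak_star X))).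
Hypothesis U_seq_compact : seq_compact U.
Variable Z : weak_star X -> weak_star X.
Hypothesis Z_fun : forall y, U y -> U (Z y).
Hypothesis Z_cont : seq_continuous_on U Z.

Section Tests.
Variables (m : nat) (d : nat -> X).

(** The scalar product of [Z y - y] and [g] after evaluation at the test vectors
    [d 0], ..., [d m.-1]. *)
Definition pairing (y g : weak_star X) : R :=
  \sum_(k < m) (ev (Z y) (d k) - ev y (d k)) * ev g (d k).

Lemma pairing_sum (I : Type) (r : seq I) (t : I -> R) (f : I -> weak_star X) y :
  pairing y (\sum_(i <- r) t i *: f i) = \sum_(i <- r) t i * pairing y (f i).
Proof.
rewrite /pairing; under eq_bigr do rewrite ev_sum mulr_sumr.
rewrite exchange_big; apply: eq_bigr => i _; rewrite mulr_sumr.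
by apply: eq_bigr => k _; rewrite evZ mulrCA.
Qed.

Lemma pairing_cvg (u v : nat -> weak_star X) (y g : weak_star X) :
  (forall n, U (u n)) -> U y -> u n @[n --> \oo] --> y ->
  v n @[n --> \oo] --> g ->
  pairing (u n) (v n) @[n --> \oo] --> pairing y g.
Proof.
move=> uU yU uy vg; apply: cvg_big => [|k _]; first exact: add_continuous.
apply: cvgM; last by move/ev_cvgP: vg; exact.
apply: cvgB; last by move/ev_cvgP: uy; exact.
by have /ev_cvgP := Z_cont uU yU uy; exact.
Qed.

(** Given [y], the left-hand side is the value of a linear form at the points
    [f i], which generate a simplex; the inequality says that [y], itself in that
    simplex up to a limit, maximizes the form.  The weights are [x i / n.+1] for
    [x] in the grid of sum [n.+1]. *)
Lemma pairing_le_fin (I : finType) (i0 : I) (f : I -> weak_star X) :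
  (forall i, U (f i)) ->
  exists2 y, U y & forall i, pairing y (f i) <= pairing y y.
Proof.
move=> fU.
pose t n (x : {ffun I -> nat}) i : R := (x i)%:R / n.+1%:R.
pose comb n x : weak_star X := \sum_i t n x i *: f i.
pose c n x := [arg max_(i > i0) pairing (comb n x) (f i)]%O.
have cP n x i : pairing (comb n x) (f i) <= pairing (comb n x) (f (c n x)).
  by rewrite /c; case: arg_maxP => // j _; exact.
have /choice[x xP] n := grid_colouring i0 n.+1 (c n).
have t_ge0 n j i : 0 <= t n (x n j) i by rewrite divr_ge0.
have t_sum n j : \sum_i t n (x n j) i = 1.
  rewrite -mulr_suml -natr_sum; have [-> _ _] := xP n.
  by rewrite divff// pnatr_eq0.
have t_le1 n j i : t n (x n j) i <= 1.
  by rewrite -(t_sum n j) (bigD1 i)//= lerDl sumr_ge0.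
have combU n j : U (comb n (x n j)) by exact: convex_set_sum.
have [s [s_homo [l lU sl]]] := U_seq_compact (fun n => combU n i0).
pose e n : R := #|I|%:R / n.+1%:R.
have e_cvg : e (s n) @[n --> \oo] --> 0.
  rewrite -[0](mulr0 #|I|%:R); apply: cvgM; first exact: cvg_cst.
  exact: cvg_comp (cvg_strict_homo_nat s_homo) (@cvg_harmonic R).
have t_close n j k i : `|t n (x n j) i - t n (x n k) i| <= e n.
  rewrite -mulrBl normrM [`|_^-1|]ger0_norm ?invr_ge0// ler_wpM2r ?invr_ge0//.
  have [_ xc _] := xP n.
  by rewrite ler_distl lerBlDr -!natrD !ler_nat !xc.
have scvg j : comb (s n) (x (s n) j) @[n --> \oo] --> l.
  apply/ev_cvgP => p.
  pose diff n := ev (comb (s n) (x (s n) j)) p - ev (comb (s n) (x (s n) i0)) p.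
  have diff0 : diff n @[n --> \oo] --> 0.
    apply/norm_cvg0P.
    apply: (@squeeze_cvgr _ _ _ _ (fun=> 0)
      (fun n => e (s n) * \sum_i `|ev (f i) p|)).
    - near=> n; rewrite normr_ge0/= /diff !ev_sum -sumrB mulr_sumr.
      apply: le_trans (ler_norm_sum _ _ _) _; apply: ler_sum => i _.
      by rewrite !evZ -mulrBl normrM ler_wpM2r.
    - exact: cvg_cst.
    - by have := cvgM e_cvg (cvg_cst (\sum_i `|ev (f i) p|)); rewrite mul0r; exact.
  have sl' : ev (comb (s n) (x (s n) i0)) p @[n --> \oo] --> ev l p.
    by move/ev_cvgP: sl; exact.
  rewrite -[ev l p]add0r; apply: cvg_trans (cvgD diff0 sl').
  by apply: near_eq_cvg; near=> n; rewrite /diff subrK.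
exists l => // i.
pose D n k := pairing (comb (s n) (x (s n) k)) (f i) -
              pairing (comb (s n) (x (s n) k)) (f k).
pose Dl k := pairing l (f i) - pairing l (f k).
have D_cvg k : D n k @[n --> \oo] --> Dl k.
  by apply: cvgB; apply: pairing_cvg => //; exact: cvg_cst.
(* If [x n k] has colour [k] then [D n k <= 0]; otherwise the weight of [f k] is
   at most [e (s n)]. *)
have tD n k : t (s n) (x (s n) i0) k * D n k <= e (s n) * `|D n k|.
  have [_ _ /(_ k)[ck|xk]] := xP (s n).
    apply: (@le_trans _ _ 0); last by rewrite mulr_ge0// divr_ge0.
    by rewrite mulr_ge0_le0// subr_le0; have := cP (s n) (x (s n) k) i; rewrite ck.
  apply: (@le_trans _ _ (t (s n) (x (s n) i0) k * `|D n k|)).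
    by rewrite ler_wpM2l// ler_norm.
  by rewrite ler_wpM2r// ler_wpM2r ?invr_ge0// ler_nat.
pose rhs n := \sum_k (`|Dl k - D n k| + e (s n) * `|D n k|).
have rhs0 : rhs n @[n --> \oo] --> 0.
  have -> : nbhs (0 : R) = nbhs (\sum_k (`|Dl k - Dl k| + 0 * `|Dl k|)).
    by rewrite big1// => k _; rewrite subrr normr0 mul0r addr0.
  apply: cvg_big => [|k _]; first exact: add_continuous.
  apply: cvgD; last by apply: cvgM e_cvg _; exact: cvg_norm.
  by apply: cvg_norm; apply: cvgB => //; exact: cvg_cst.
have lhs_cvg : pairing l (f i) - pairing l (comb (s n) (x (s n) i0)) @[n --> \oo]
    --> pairing l (f i) - pairing l l.
  by apply: cvgB (cvg_cst _) (pairing_cvg _ lU (cvg_cst _) (scvg i0)).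
rewrite -subr_le0; apply: ler_cvg_to lhs_cvg rhs0 _.
near=> n.
have -> : pairing l (f i) - pairing l (comb (s n) (x (s n) i0)) =
    \sum_k t (s n) (x (s n) i0) k * Dl k.
  rewrite pairing_sum -[X in X - _]mul1r -(t_sum (s n) i0) mulr_suml -sumrB.
  by apply: eq_bigr => k _; rewrite mulrBr.
apply: ler_sum => k _.
rewrite -[Dl k in leLHS](subrK (D n k)) mulrDr lerD//.
apply: le_trans (ler_norm _) _; rewrite normrM ger0_norm//.
by rewrite ler_piMl.
Unshelve. all: by end_near.
Qed.

Lemma pairing_le_seq (L : seq (weak_star X)) : {in L, forall g, U g} ->
  exists2 y, U y & {in L, forall g, pairing y g <= pairing y y}.
Proof.
case: L => [_|g0 L LU]; first by have [y Uy] := U_neq0; exists y.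
have [i|y yU yL] := @pairing_le_fin _ ord0 (tnth (in_tuple (g0 :: L))).
  by apply: LU; exact: mem_tnth.
exists y => // g /(nthP 0)[i iL <-].
by have := yL (Ordinal iL); rewrite (tnth_nth 0).
Qed.

(** Each [y n] satisfies the variational inequality for the images under [Z] of
    all the previous ones, collected in the list [L n]. *)
Lemma fixed_on_tests : exists2 y, U y &
  forall k, (k < m)%N -> ev (Z y) (d k) = ev y (d k).
Proof.
have /choice[h hP] (L : seq (weak_star X)) : exists y, {in L, forall g, U g} ->
    U y /\ {in L, forall g, pairing y g <= pairing y y}.
  have [LU|nLU] := pselect {in L, forall g, U g}; last by exists 0.
  by have [y yU yL] := pairing_le_seq LU; exists y.
pose L n := iter n (fun L => Z (h L) :: L) [::].
have LU n : {in L n, forall g, U g}.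
  elim: n => [//|n IH] g; rewrite inE => /predU1P[->|/IH//].
  by apply: Z_fun; case: (hP _ IH).
pose y n := h (L n).
have yU n : U (y n) by case: (hP _ (LU n)).
have ZyL i n : (i < n)%N -> Z (y i) \in L n.
  elim: n => // n IH; rewrite ltnS leq_eqVlt inE => /predU1P[->|/IH ->].
    by rewrite eqxx.
  by rewrite orbT.
have [s [s_homo [l lU sl]]] := U_seq_compact yU.
have sl1 : y (s n.+1) @[n --> \oo] --> l.
  exact: cvg_comp (@cvg_strict_homo_nat succn _) sl.
have Zsl : Z (y (s n)) @[n --> \oo] --> Z l by exact: Z_cont.
have le_lim : pairing l (Z l) <= pairing l l.
  (* The index [s n.+1] is larger than [s n], so that the inequality for
     [y (s n.+1)] applies to [Z (y (s n))]. *)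
  apply: ler_cvg_to (pairing_cvg _ lU sl1 Zsl) (pairing_cvg _ lU sl1 sl1) _ => //.
  near=> n; have [_] := hP _ (LU (s n.+1)); apply; apply: ZyL.
  exact: s_homo.
have sq0 : \sum_(k < m) (ev (Z l) (d k) - ev l (d k)) ^+ 2 <= 0.
  rewrite (_ : \sum_(k < m) _ = pairing l (Z l) - pairing l l) ?subr_le0//.
  by rewrite /pairing -sumrB; apply: eq_bigr => k _; rewrite -mulrBr expr2.
exists l => // k km; apply/eqP; rewrite -subr_eq0 -sqrf_eq0.
have : \sum_(k < m) (ev (Z l) (d k) - ev l (d k)) ^+ 2 == 0.
  by rewrite eq_le sq0 sumr_ge0// => *; exact: sqr_ge0.
rewrite psumr_eq0 => [/allP/(_ (Ordinal km))|*]; last exact: sqr_ge0.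
by apply; exact: mem_index_enum.
Unshelve. all: by end_near. Qed.

End Tests.

Theorem weak_star_fixed_point (d : nat -> X) :
  dense (range d) -> exists2 y, U y & Z y = y.
Proof.
move=> d_dense.
have /choice[y yP] m : exists y, U y /\
    forall k, (k < m)%N -> ev (Z y) (d k) = ev y (d k).
  by have [y] := fixed_on_tests m d; exists y.
have yU m := (yP m).1.
have [s [s_homo [l lU sl]]] := U_seq_compact yU.
have Zsl : Z (y (s n)) @[n --> \oo] --> Z l by exact: Z_cont.
have Zld k : ev (Z l) (d k) = ev l (d k).
  move/ev_cvgP : (sl) => /(_ (d k)) slk; move/ev_cvgP : Zsl => /(_ (d k)) Zslk.
  apply: (cvg_unique _ Zslk); first exact: norm_hausdorff.
  apply: cvg_trans slk; apply: near_eq_cvg; near=> n.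
  apply/esym/(yP _).2; near: n.
  exact: (cvg_strict_homo_nat s_homo (nbhs_infty_gt k)).
exists l => //; apply: ev_inj => x; apply/eqP; rewrite -subr_eq0.
apply/negPn/negP => x0.
pose g x := ev (Z l) x - ev l x.
have g_cont : continuous g by move=> z; apply: cvgB; exact: ev_continuous.
have [||z [gz [k _ kz]]] := d_dense (g @^-1` [set z | z != 0]).
- by exists x.
- by apply: open_comp => [z _|]; [exact: g_cont|exact: open_neq].
- by move: gz; rewrite /= /g -kz Zld subrr eqxx.
Unshelve. all: by end_near. Qed.

End FixedPoint.

Theorem theorem4p1 (R : realType) (X : completeNormedModType R)
    (sepX : separable_space X) (Upsilon : set (weak_star X))
    (Upsilon_neq0 : Upsilon !=set0)
    (Upsilon_convex : convex_set (Upsilon : set (convex_lmodType (weak_star X))))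
    (Upsilon_seq_compact : seq_compact Upsilon)
    (Z : {fun Upsilon >-> Upsilon})
    (Z_seq_continuous : seq_continuous_on Upsilon Z) :
  exists2 y : weak_star X, Upsilon y & Z y = y.
Proof.
have [D cD dD] := sepX.
have [d Dd] : exists d : nat -> X, D `<=` range d.
  have /countable_injP[f f_inj] := cD.
  (* The default value 0 is taken at the integers outside the image of [f]. *)
  exists (fun n => xget 0 [set x | D x /\ f x = n]) => x Dx.
  exists (f x) => //; case: xgetP => [z _ [Dz fz]|/(_ x)[]//].
  by apply: f_inj => //; exact/mem_set.
apply: (weak_star_fixed_point (Z := Z) (d := d) Upsilon_neq0 Upsilon_convex
  Upsilon_seq_compact _ Z_seq_continuous).
  by move=> y; exact: funS.
move=> O O0 oO; have [x [Ox Dx]] := dD O O0 oO.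
by exists x; split => //; exact: Dd.
Qed.
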